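(* Let $G$ be a totally disconnected, locally compact group with property (LD). Then $G$ has a characteristic closed subgroup $Q$ such that $G/Q$ has property (LD), $\mathrm{QZ}(G/Q)=\{1\}$, and $\overline{\mathrm{QZ}(Q)}$ is open in $Q$.
   Context: All groups are locally compact Hausdorff topological groups. Direct products carry the product topology; direct factors are closed subgroups. Property (LD): a totally disconnected locally compact group $G$ has property (LD) if for every closed subgroup $K$ of $G$ with open normalizer, there is an open subgroup $L$ of $K$ that is a direct factor of an open subgroup of $G$. The quasi-centre $\mathrm{QZ}(G)$ is the set of all elements of $G$ with open centralizer in $G$. Characteristic means invariant under all topological group automorphisms. *)

(* Defs.v *)
From HB Require Import structures.
From mathcomp Require Import all_boot all_order all_algebra generic_quotient.
From mathcomp Require Import all_classical.
From mathcomp Require Import topology.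

Set Implicit Arguments.
Unset Strict Implicit.
Unset Printing Implicit Defensive.

Local Open Scope classical_set_scope.
Local Open Scope group_scope.

HB.mixin Record isTopologicalGroup G of Group G & Topological G := {
  mulg_continuous : continuous (fun p : G * G => p.1 * p.2);
  invg_continuous : continuous (fun x : G => x^-1)
}.

#[short(type="topGroupType")]
HB.structure Definition TopologicalGroup :=
  {G of Group G & Topological G & isTopologicalGroup G}.

Definition homeomorphism (X Y : topologicalType) (A : set X) (B : set Y)
    (f : X -> Y) : Prop :=
  [/\ set_bij A B f,
      {within A, continuous f} &
      exists2 g : Y -> X, {in A, cancel f g} & {within B, continuous g}].

Section Subgroups.
Variable G : topGroupType.
Implicit Types H K L M Q U : set G.

Definition subgroup H : Prop :=
  H 1 /\ forall x y : G, H x -> H y -> H (x / y).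

(* For [U `<=` H], [open (U : set (subspace H))] is openness of U in the
   subspace topology of H, and likewise for [closed] and [closure]. *)
Definition open_subgroup H U : Prop :=
  [/\ subgroup U, U `<=` H & open (U : set (subspace H))].

Definition closed_subgroup H F : Prop :=
  [/\ subgroup F, F `<=` H & closed (F : set (subspace H))].

Definition normalizer K : set G := [set g | (fun x : G => x ^ g) @` K = K].

Definition centralizer1 H (x : G) : set G := [set y | H y /\ commute x y].

Definition QZ H : set G :=
  [set x | H x /\ open (centralizer1 H x : set (subspace H))].

(* U is L x M as a topological group. *)
Definition direct_product U L M : Prop :=
  [/\ closed_subgroup U L,
      closed_subgroup U M,
      forall x y : G, L x -> M y -> commute x y &
      homeomorphism (L `*` M) U (fun p : G * G => p.1 * p.2)].

Definition direct_factor U L : Prop := exists M, direct_product U L M.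

Definition topological_automorphism (f : G -> G) : Prop :=
  {morph f : x y / x * y} /\ homeomorphism [set: G] [set: G] f.

Definition characteristic Q : Prop :=
  forall f : G -> G, topological_automorphism f -> f @` Q = Q.

End Subgroups.

Definition tdlc (G : topGroupType) : Prop :=
  [/\ hausdorff_space G,
      locally_compact [set: G] &
      totally_disconnected [set: G]].

(* Only a totally disconnected, locally compact group can have (LD). *)
Definition propertyLD (G : topGroupType) : Prop :=
  tdlc G /\
  forall K : set G, subgroup K -> closed K -> open (normalizer K) ->
  exists L U : set G,
    [/\ open_subgroup K L, subgroup U, open U & direct_factor U L].

Record normal_subgroup (G : topGroupType) := NormalSubgroup {
  normal_set :> set G;
  normal_subgroupP : subgroup normal_set;
  normal_conj : forall x g : G, normal_set x -> normal_set (x ^ g)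
}.

Section Quotient.
Variables (G : topGroupType) (Q : normal_subgroup G).
Local Open Scope quotient_scope.
Local Notation S := (normal_set Q).

Let S1 : S 1. Proof. by case: (normal_subgroupP Q). Qed.
Let SV x : S x -> S x^-1.
Proof. by case: (normal_subgroupP Q) => _ SB /(SB 1 _ S1); rewrite div1g. Qed.
Let SM x y : S x -> S y -> S (x * y).
Proof.
move=> Sx /SV Sy.
by case: (normal_subgroupP Q) => _ /(_ _ _ Sx Sy); rewrite invgK.
Qed.

Definition coset_rel : rel G := fun x y => `[< S (x^-1 * y) >].

Fact coset_rel_refl : reflexive coset_rel.
Proof. by move=> x; apply/asboolP; rewrite mulVg. Qed.

Fact coset_rel_sym : symmetric coset_rel.
Proof.
by move=> x y; apply/asboolP/asboolP => /SV; rewrite invgM invgK.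
Qed.

Fact coset_rel_trans : transitive coset_rel.
Proof.
move=> y x z /asboolP xy /asboolP yz; apply/asboolP.
by have := SM xy yz; rewrite mulgA mulgK.
Qed.

Canonical coset_equiv :=
  EquivRel coset_rel coset_rel_refl coset_rel_sym coset_rel_trans.

(* The group G / Q of left cosets, with the quotient topology. *)
Definition quotient_group : Type := quotient_topology {eq_quot coset_equiv}.

HB.instance Definition _ := Topological.on quotient_group.
HB.instance Definition _ := Quotient.on quotient_group.

Local Notation pi := (\pi_quotient_group : G -> quotient_group).

Fact quotient_piP (x y : G) : pi x = pi y <-> S (x^-1 * y).
Proof.
split=> [e|h].
  by apply/asboolP; apply/(@eqmodP _ coset_equiv); exact: e.
by apply/(@eqmodP _ coset_equiv); apply/asboolP.
Qed.

Definition quotient_one : quotient_group := pi 1.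
Definition quotient_inv (u : quotient_group) : quotient_group :=
  pi (repr u)^-1.
Definition quotient_mul (u v : quotient_group) : quotient_group :=
  pi (repr u * repr v).

Let piK (u : quotient_group) : pi (repr u) = u.
Proof. exact: reprK. Qed.

Fact quotient_pi_inv (x : G) : quotient_inv (pi x) = pi x^-1.
Proof.
apply/quotient_piP; rewrite invgK; set a := repr _.
have /quotient_piP/SV h : pi a = pi x by exact: piK.
have := normal_conj x^-1 h; rewrite /conjg invgM !invgK.
by rewrite !mulgA mulgV mul1g.
Qed.

Fact quotient_pi_mul (x y : G) : quotient_mul (pi x) (pi y) = pi (x * y).
Proof.
apply/quotient_piP; set a := repr _; set b := repr _.
have /quotient_piP ha : pi a = pi x by exact: piK.
have /quotient_piP hb : pi b = pi y by exact: piK.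
have := SM (normal_conj b ha) hb; rewrite /conjg invgM.
by rewrite !mulgA mulgK.
Qed.

Fact quotient_mulA : associative quotient_mul.
Proof.
move=> u v w; rewrite -(piK u) -(piK v) -(piK w).
by rewrite !quotient_pi_mul mulgA.
Qed.

Fact quotient_mul1 : left_id quotient_one quotient_mul.
Proof. by move=> u; rewrite -(piK u) quotient_pi_mul mul1g. Qed.

Fact quotient_1mul : right_id quotient_one quotient_mul.
Proof. by move=> u; rewrite -(piK u) quotient_pi_mul mulg1. Qed.

Fact quotient_mulV : left_inverse quotient_one quotient_inv quotient_mul.
Proof. by move=> u; rewrite -(piK u) quotient_pi_inv quotient_pi_mul mulVg. Qed.

Fact quotient_Vmul : right_inverse quotient_one quotient_inv quotient_mul.
Proof. by move=> u; rewrite -(piK u) quotient_pi_inv quotient_pi_mul mulgV. Qed.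

HB.instance Definition _ := isGroup.Build quotient_group
  quotient_mulA quotient_mul1 quotient_1mul quotient_mulV quotient_Vmul.

Fact quotient_pi_continuous : continuous pi.
Proof. exact: (@pi_continuous _ {eq_quot coset_equiv}). Qed.

Fact quotient_pi_open (U : set G) : open U -> open (pi @` U).
Proof.
move=> oU; change (open (pi @^-1` (pi @` U))).
have -> : pi @^-1` (pi @` U) =
    \bigcup_(s in S) ((fun x : G => x * s) @^-1` U).
  apply/seteqP; split => [x [y Uy /esym/quotient_piP h]|x [s Ss Us]].
    by exists (x^-1 * y) => //=; rewrite mulgA mulgV mul1g.
  by exists (x * s) => //; apply/esym/quotient_piP; rewrite mulgA mulVg mul1g.
apply: bigcup_open => s _; apply: open_comp => // x _.
have c : {for x, continuous (fun x : G => (x, s))}.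
  by apply: cvg_pair => //; exact: cvg_cst.
exact: (continuous_comp c (mulg_continuous _)).
Qed.

Fact quotient_mul_continuous :
  continuous (fun p : quotient_group * quotient_group => p.1 * p.2).
Proof.
move=> [u v] W /=; rewrite -(piK u) -(piK v).
set a := repr u; set b := repr v.
have -> : pi a * pi b = pi (a * b) by exact: quotient_pi_mul.
move=> /(@quotient_pi_continuous (a * b)) nW.
have := @mulg_continuous G (a, b) _ nW.
move=> [[A B] /= [nA nB] AB].
have img (c : G) (C : set G) : nbhs c C -> nbhs (pi c) (pi @` C).
  rewrite nbhsE => -[D [oD Dc] DC]; rewrite nbhsE.
  exists (pi @` D); last exact: image_subset.
  by split; [exact: quotient_pi_open | exists c].
exists (pi @` A, pi @` B); first by split; exact: img.
move=> [_ _] /= [[x Ax <-] [y By <-]].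
have -> : pi x * pi y = pi (x * y) by exact: quotient_pi_mul.
exact: (AB (x, y)).
Qed.

Fact quotient_inv_continuous : continuous (fun u : quotient_group => u^-1).
Proof.
apply/(@quotient_continuous _ {eq_quot coset_equiv}).
have -> : (fun u : quotient_group => u^-1) \o pi = pi \o (fun x : G => x^-1).
  by apply/funext => x; exact: quotient_pi_inv.
move=> x; apply: continuous_comp; first exact: invg_continuous.
exact: quotient_pi_continuous.
Qed.

HB.instance Definition _ := isTopologicalGroup.Build quotient_group
  quotient_mul_continuous quotient_inv_continuous.

End Quotient.

(* Main.v *)
Require Import Defs.
From mathcomp Require Import all_boot all_order all_algebra generic_quotient.
From mathcomp Require Import all_classical.
From mathcomp Require Import topology.

(** The subgroup is obtained by killing the quasi-centre twice.  Let R be the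
    closure of QZ(G) and let Q be the set of all g such that [~ g, u] lies in R
    for every u close enough to 1; thus Q / R is the quasi-centre of G / R.
    Both R and Q are defined from the topological group G alone, so they are
    characteristic, and in particular normal.

    Property (LD) is used twice.  Applied to R, it gives an open subgroup U of G
    that is a direct product of an open subgroup L of R and a subgroup M.  Then
    M meets R in a discrete subgroup, and van Dantzig's theorem (open subgroups
    form a neighbourhood basis of 1) lets M be shrunk until it meets R trivially
    ([LD_complement]).  An element x of M that lies in Q commutes with the
    elements of M near 1, because such commutators lie in M and in R, and it
    commutes with L; hence x has an open centralizer, so x lies in QZ(G), which
    is inside R, and x = 1 ([QZmod_complement]).

    So M is a local complement to Q as well as to R, and the conclusions follow.
    Near 1 the groups Q and R coincide ([QZmod_near]).  Hence Q is closed; the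
    closure of QZ(Q), which contains R, is open in Q; and if g commutes modulo Q
    with the elements near 1, then it does so modulo R, so g is in Q and G / Q
    has trivial quasi-centre.

    For (LD) in G / Q ([image_propertyLD]), the quotient map restricts to an
    isomorphism from M onto an open subgroup.  Let K be a closed subgroup of
    G / Q with open normalizer, and P the part of M that maps into K.  As L
    centralizes M, the normalizer of P in G is open, so (LD) in G, used for the
    second time, provides an open subgroup V = A x B of G with A open in P.  By
    Dedekind's modular law V `&` M = A x (B `&` M), and the image of this
    decomposition in G / Q is the one required. *)

Set Implicit Arguments.
Unset Strict Implicit.
Unset Printing Implicit Defensive.

Local Open Scope classical_set_scope.
Local Open Scope group_scope.

(** * Compact open neighbourhoods in totally disconnected spaces *)

Definition quasi_component (T : topologicalType) (x : T) : set T :=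
  [set y | forall C : set T, clopen C -> C x -> C y].

(** The complement of O in K is compact and each of its points is missed by some
    clopen set around x, so finitely many of these clopen sets, intersected,
    miss all of it. *)
Lemma clopen_sub_of_quasi_component (T : topologicalType) (K O : set T) (x : T) :
  compact K -> clopen K -> K x -> open O -> quasi_component x `<=` O ->
  exists C, [/\ clopen C, C x & C `<=` K `&` O].
Proof.
move=> cptK clK Kx oO qO.
pose F := filter_from [set D : set T | D x /\ clopen D] id.
have FF : Filter F.
  apply: filter_from_filter; first by exists setT; split => //; exact: clopenT.
  by move=> A B [? ?] [? ?]; exists (A `&` B) => //; split=> //; exact: clopenI.
have PF : ProperFilter F by apply: filter_from_proper => D [Dx _]; exists x.
have /(iffLR (compact_near_coveringP _)) : compact (K `&` ~` O).
  by apply: compact_closedI => //; exact: open_closedC.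
move=> /(_ _ _ setC (powerset_filter_from_filter PF))[].
  move=> y [Ky nOy].
  have [C [clC Cx nCy]] : exists C : set T, [/\ clopen C, C x & ~ C y].
    apply: contrapT => h; apply/nOy/qO => C clC Cx.
    by apply: contrapT => nCy; apply: h; exists C.
  have [oC cC] := clC.
  exists (~` C, [set U | U `<=` C]); first split.
  - by apply: open_nbhs_nbhs; split => //; exact: closed_openC.
  - apply/near_powerset_filter_fromP; first by move=> ? ?; exact: subset_trans.
    by exists C => //; exists C.
  - by case=> i j [? /subsetC]; apply.
move=> D [DF _ [C DC]] /(_ _ DC) KOC.
have [E [Ex clE] EC] := DF _ DC.
exists (K `&` E); split => //; first exact: clopenI.
move=> y [Ky /EC Cy]; split=> //; apply: contrapT => nOy.
exact: (KOC y).
Qed.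

(** In a compact Hausdorff space quasi-components are connected: if the
    quasi-component of x were a disjoint union of two closed pieces, normality
    would separate them by open sets; a clopen set around x inside the union of
    these would be cut into two clopen halves, and x lies in only one of them.
    The argument takes place in [subspace K], where K is both
    clopen and compact, so that normality is available around any closed part
    of K. *)
Lemma quasi_component_connected (X : topologicalType) (K : set X) (x : X) :
  hausdorff_space X -> compact K -> K x ->
  connected (quasi_component (x : subspace K) : set X).
Proof.
move=> hX cptK Kx; set q := (X in connected X).
have clopenK : @clopen (subspace K) K.
  by split; [exact: open_subspaceT | exact: closed_subspaceT].
have cptK' : compact (K : set (subspace K)).
  by rewrite -[X in compact X]setIid; apply/compact_subspaceIP; rewrite setIid.
have qK : q `<=` K by move=> y; apply.
have qx : q x by move=> C.
have qcl : closed (q : set (subspace K)).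
  rewrite (_ : (q : set (subspace K)) =
    \bigcap_(C in [set C : set (subspace K) | clopen C /\ C x]) C).
    by apply: closed_bigI => C [[]].
  by apply/seteqP; split=> [y qy C [? ?]|y qy C ? ?]; apply: qy.
move=> E [e Ee] [C1 oC1 EC1] [C2 cC2 EC2].
have cE : closed (E : set (subspace K)).
  by rewrite EC2; apply: closedI => //; exact: closed_subspaceW.
have oE' : open (~` (q `&` ~` C1) : set (subspace K)).
  apply: closed_openC; apply: closedI => //; apply: open_closedC.
  exact: open_subspaceW.
have hK : hausdorff_space (subspace K) by exact: subspace_hausdorff.
have EK : (E : set (subspace K)) `<=` (K : set (subspace K))°.
  have [oK _] := clopenK.
  by rewrite (interior_id _).1// EC1 => y [/qK].
have : set_nbhs (E : set (subspace K)) (~` (q `&` ~` C1)).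
  move=> y; rewrite EC1 => -[qy C1y]; apply: open_nbhs_nbhs; split => //.
  by case.
move=> /(compact_normal_local hK cptK' EK cE)[C nC CE].
have oO : open (C° `|` ~` closure C).
  by apply: openU; [exact: open_interior | exact/closed_openC/closed_closure].
have EC : E `<=` C° by move=> y /nC.
have [|P [[oP cP] Px PO]] := clopen_sub_of_quasi_component cptK' clopenK Kx oO.
  move=> y qy; have [C1y|C1y] := pselect (C1 y).
    by left; apply: EC; rewrite EC1; split.
  by right=> Cy; apply: (CE _ Cy); split.
(* P avoids the boundary of C, so C cuts P into two clopen halves. *)
have PC : P `&` C° = P `&` closure C.
  apply/seteqP; split=> [y [Py Cy]|y [Py Cy]]; split=> //.
    exact: subset_closure (interior_subset Cy).
  by have [_ []] := PO _ Py.
have clPC : clopen (P `&` C°).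
  split; first by apply: openI => //; exact: open_interior.
  by rewrite PC; apply: closedI => //; exact: closed_closure.
have [Cx|nCx] := pselect (C° x).
  apply/seteqP; split=> [y|y qy]; first by rewrite EC1 => -[].
  have [_ Cy] := qy _ clPC (conj Px Cx).
  rewrite EC1; split=> //; apply: contrapT => nC1y.
  by apply: (CE _ (subset_closure (interior_subset Cy))); split.
have qe : q e by move: Ee; rewrite EC1 => -[].
exfalso; apply: (qe (~` (P `&` C°)) (clopenC set0 clPC) (fun h => nCx h.2)).
by split; [exact: qe (conj oP cP) Px | exact: EC].
Qed.

(** Inside a compact neighbourhood K of x the quasi-component of x is connected,
    hence reduced to x, so some relatively clopen subset of K around x fits into
    the interior of K, where relatively open means open. *)
Lemma compact_open_nbhs (X : topologicalType) (x : X) (W : set X) :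
  hausdorff_space X -> locally_compact [set: X] ->
  totally_disconnected [set: X] -> nbhs x W ->
  exists O : set X, [/\ open O, compact O, O x & O `<=` W].
Proof.
move=> hX lcX tdX nW.
have [K + [cptK clK]] := lcX x I; rewrite withinET => nK.
have Kx : K x := nbhs_singleton nK.
have clopenK : @clopen (subspace K) K.
  by split; [exact: open_subspaceT | exact: closed_subspaceT].
have cptK' : compact (K : set (subspace K)).
  by rewrite -[X in compact X]setIid; apply/compact_subspaceIP; rewrite setIid.
have oO : open ((W `&` K)° : set (subspace K)).
  by apply: open_subspaceW; exact: open_interior.
have [|C [[oC cC] Cx CO]] := clopen_sub_of_quasi_component cptK' clopenK Kx oO.
  move=> y qy; suff -> : y = x by exact: filterI.
  suff : connected_component [set: X] x y by rewrite tdX.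
  exists (quasi_component (x : subspace K)) => //; split=> //.
  exact: quasi_component_connected.
have CW : C `<=` (W `&` K)° by move=> y /CO[].
have CK : C `<=` K by move=> y /CO[].
exists C; split=> //.
- move/open_subspaceP : oC => [V oV VC].
  have -> : C = V `&` (W `&` K)°.
    apply/seteqP; split=> y.
      move=> Cy; split; last exact: CW.
      by have [+ _] : (V `&` K) y by rewrite VC; split=> //; exact: CK.
    move=> [Vy /interior_subset[_ Ky]].
    by have [+ _] : (C `&` K) y by rewrite -VC; split.
  by apply: openI => //; exact: open_interior.
- apply: (subclosed_compact _ cptK CK).
  move/closed_subspaceP : cC => [V cV VC].
  have -> : C = V `&` K by rewrite VC; exact/esym/setIidPl.
  exact: closedI.
- by move=> y /CW/interior_subset[].
Qed.

(** * Subgroups and neighbourhoods of the identity *)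

Section Subgroups.
Variable G : topGroupType.
Implicit Types (H T U V A : set G) (x y u : G).

Lemma subgroup1 H : subgroup H -> H 1.
Proof. by case. Qed.

Lemma subgroupV H x : subgroup H -> H x -> H x^-1.
Proof. by move=> [H1 HB] Hx; rewrite -div1g; exact: HB. Qed.

Lemma subgroupM H x y : subgroup H -> H x -> H y -> H (x * y).
Proof. by move=> sH Hx /(subgroupV sH)/(sH.2 _ _ Hx); rewrite invgK. Qed.

Lemma subgroup_cancell H x y : subgroup H -> H x -> H (x * y) -> H y.
Proof.
by move=> sH /(subgroupV sH) Hx /(subgroupM sH Hx); rewrite mulgA mulVg mul1g.
Qed.

Lemma subgroupP H : H 1 -> (forall x, H x -> H x^-1) ->
  (forall x y, H x -> H y -> H (x * y)) -> subgroup H.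
Proof. by move=> H1 HV HM; split=> // x y Hx /HV; exact: HM. Qed.

Lemma subgroupT : subgroup [set: G]. Proof. by []. Qed.

Lemma subgroupI H T : subgroup H -> subgroup T -> subgroup (H `&` T).
Proof.
move=> sH sT; split; first by split; exact: subgroup1.
by move=> x y [Hx Tx] [Hy Ty]; split; [exact: sH.2|exact: sT.2].
Qed.

Lemma continuous_mulg (S : topologicalType) (f g : S -> G) :
  continuous f -> continuous g -> continuous (fun s => f s * g s).
Proof.
move=> cf cg s; apply: (@continuous_comp _ _ _ (fun s => (f s, g s))
  (fun p : G * G => p.1 * p.2)); last exact: mulg_continuous.
by apply: cvg_pair; [exact: cf|exact: cg].
Qed.

Lemma continuous_invg (S : topologicalType) (f : S -> G) :
  continuous f -> continuous (fun s => (f s)^-1).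
Proof. by move=> cf s; apply: continuous_comp; [exact: cf|exact: invg_continuous]. Qed.

Lemma continuous_mull x : continuous (fun u => x * u).
Proof.
by apply: continuous_mulg; move=> ?; [exact: cvg_cst|exact: cvg_id].
Qed.

Lemma continuous_conjg x : continuous (fun u => u ^ x).
Proof.
apply: continuous_mulg; first by move=> ?; exact: cvg_cst.
by apply: continuous_mulg; [move=> ?; exact: cvg_id | move=> ?; exact: cvg_cst].
Qed.

Lemma continuous_commg x : continuous (fun u => [~ x, u]).
Proof.
apply: continuous_mulg; first by move=> ?; exact: cvg_cst.
apply: continuous_mulg; first by apply: continuous_invg => ?; exact: cvg_id.
by apply: continuous_mulg; [move=> ?; exact: cvg_cst | move=> ?; exact: cvg_id].
Qed.

Lemma nbhs_mulP x A : nbhs x A <-> \forall u \near (1 : G), A (x * u).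
Proof.
split=> nA; first by have := @continuous_mull x 1 A; rewrite mulg1; exact.
have nxA : nbhs x [set y | A (x * (x^-1 * y))].
  by have := @continuous_mull x^-1 x [set u | A (x * u)]; rewrite mulVg; exact.
by apply: filterS nxA => y /=; rewrite mulgA mulgV mul1g.
Qed.

(** A subgroup is a union of translates of any neighbourhood of 1 that it
    contains. *)
Lemma open_subgroupP T : subgroup T -> open T <-> nbhs (1 : G) T.
Proof.
move=> sT; split=> [oT|nT]; first by apply: open_nbhs_nbhs; split=> //; exact: subgroup1.
rewrite openE => x Tx; apply/nbhs_mulP; apply: filterS nT => u Tu.
exact: subgroupM.
Qed.

Lemma open_in_subgroupP H T : subgroup H -> subgroup T -> T `<=` H ->
  open (T : set (subspace H)) <-> \forall u \near (1 : G), H u -> T u.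
Proof.
move=> sH sT TH; split.
  move=> /open_subspaceP[V oV VT].
  have nV : nbhs (1 : G) V.
    apply: open_nbhs_nbhs; split=> //.
    have [+ _] : (V `&` H) 1 by rewrite VT; split; exact: subgroup1.
    by [].
  apply: filterS nV => u Vu Hu.
  by have [] : (T `&` H) u by rewrite -VT.
rewrite /prop_near1 nbhsE => -[W [oW W1] WT]; apply/open_subspaceP.
exists (\bigcup_(t in T) ((fun u => t^-1 * u) @^-1` W)).
  apply: bigcup_open => t _; move: W oW {W1 WT}; apply/continuousP.
  exact: continuous_mull.
apply/seteqP; split=> [u [[t Tt /= Wu] Hu]|u [Tu Hu]]; split=> //; last first.
  by exists u => //=; rewrite mulVg.
have : T (t^-1 * u).
  by apply: WT => //; apply: (subgroupM sH _ Hu); exact: TH (subgroupV sT Tt).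
by move/(subgroupM sT Tt); rewrite mulgA mulgV mul1g.
Qed.

Lemma open_subgroup_closed T : subgroup T -> open T -> closed T.
Proof.
move=> sT /(open_subgroupP sT) nT x clx.
have nxT : nbhs x [set y | T (x^-1 * y)].
  by apply/nbhs_mulP; apply: filterS nT => u Tu /=; rewrite mulgA mulVg mul1g.
have [y [Ty Txy]] := clx _ nxT.
have := sT.2 _ _ Ty Txy; rewrite invgM invgK mulgA mulgV mul1g.
by [].
Qed.

(** Division is continuous, so it maps the closure of T x T into the closure of
    T. *)
Lemma closure_subgroup T : subgroup T -> subgroup (closure T).
Proof.
move=> sT; split; first exact: subset_closure (subgroup1 sT).
move=> x y clx cly A.
have : continuous (fun p : G * G => p.1 / p.2).
  apply: continuous_mulg; first by move=> ?; exact: cvg_fst.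
  by apply: continuous_invg => ?; exact: cvg_snd.
move=> /(_ (x, y) A) /[apply] -[[B C] /= [nB nC] BC].
have [b [Tb Bb]] := clx _ nB.
have [c [Tc Cc]] := cly _ nC.
by exists (b / c); split; [exact: sT.2 | exact: (BC (b, c))].
Qed.

(** A locally closed subgroup is closed: near a limit point x of H, all elements
    of H lie in one coset q * T with q in H, and that coset is closed. *)
Lemma closed_of_locally_closed H T : subgroup H -> subgroup T ->
  closed T -> T `<=` H -> (\forall u \near (1 : G), H u -> T u) -> closed H.
Proof.
move=> sH sT cT TH nT x clx.
have : continuous (fun p : G * G => (x * p.1)^-1 * (x * p.2)).
  apply: continuous_mulg; first apply: continuous_invg.
    by apply: continuous_mulg => ?; [exact: cvg_cst|exact: cvg_fst].
  by apply: continuous_mulg => ?; [exact: cvg_cst|exact: cvg_snd].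
move=> /(_ (1, 1)) c.
have /c : nbhs ((x * 1)^-1 * (x * 1) : G) [set u | H u -> T u] by rewrite mulVg.
move=> [[B C] /= [nB nC] BC].
have nxB : nbhs x [set y | B (x^-1 * y) /\ C (x^-1 * y)].
  apply/nbhs_mulP; apply: filterS (filterI nB nC) => u [Bu Cu] /=.
  by rewrite mulgA mulVg mul1g.
have [q [Hq [Bq _]]] := clx _ nxB.
suff : T (q^-1 * x).
  by move/TH => /(subgroupM sH Hq); rewrite mulgA mulgV mul1g.
apply: cT => A nA.
have nqA : nbhs x [set y | A (q^-1 * y)] by exact: (@continuous_mull q^-1 x _ nA).
have [r [Hr [[_ Cr] Ar]]] := clx _ (filterI nxB nqA).
exists (q^-1 * r); split=> //.
have := BC (x^-1 * q, x^-1 * r) (conj Bq Cr) => /=.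
rewrite ![x * (_ * _)]mulgA mulgV !mul1g; apply.
by apply: subgroupM => //; exact: subgroupV.
Qed.

Lemma closed1_hausdorff : closed [set (1 : G)] -> hausdorff_space G.
Proof.
move=> c1 x y cxy; apply: contrapT => nxy.
have : continuous (fun p : G * G => p.1^-1 * p.2).
  apply: continuous_mulg; last by move=> ?; exact: cvg_snd.
  by apply: continuous_invg => ?; exact: cvg_fst.
have nN : nbhs (x^-1 * y) (~` [set (1 : G)]).
  apply: open_nbhs_nbhs; split; first exact: closed_openC.
  by move=> /= h; apply: nxy; rewrite -(mulg1 x) -h mulgA mulgV mul1g.
move=> /(_ (x, y) _ nN)[[B C] /= [nB nC] BC].
have [z [Bz Cz]] := cxy _ _ nB nC.
by apply: (BC (z, z)) => //=; rewrite mulVg.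
Qed.

(** Translates of open subgroups are clopen, so such subgroups separate
    points. *)
Lemma open_subgroup_totally_disconnected :
  (forall x, x <> 1 -> exists V, [/\ subgroup V, open V & ~ V x]) ->
  totally_disconnected [set: G].
Proof.
move=> h; apply: zero_dimension_totally_disconnected => x y /eqP nxy.
have [|V [sV oV Vxy]] := h (x^-1 * y).
  by move=> e; apply: nxy; rewrite -(mulg1 x) -e mulgA mulgV mul1g.
exists ((fun u => x^-1 * u) @^-1` V); split=> //; last by rewrite /= mulVg; exact: subgroup1.
split.
  by move: V oV {sV Vxy}; apply/continuousP; exact: continuous_mull.
have := open_subgroup_closed sV oV.
by move: V {oV sV Vxy}; apply/continuous_closedP; exact: continuous_mull.
Qed.

(** Van Dantzig's theorem.  The right stabilizer of a compact open set O is a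
    subgroup; compactness of O makes it a neighbourhood of 1 (tube lemma), and
    it lies in O when O contains 1. *)
Lemma van_dantzig A : tdlc G -> nbhs (1 : G) A ->
  exists V, [/\ subgroup V, open V & V `<=` A].
Proof.
move=> [hG lG tG] nA.
have [O [oO cptO O1 OA]] := compact_open_nbhs hG lG tG nA.
pose V : set G := [set g | forall x, O x -> O (x * g) /\ O (x / g)].
have sV : subgroup V.
  apply: subgroupP => [x Ox|g Vg x Ox|g h Vg Vh x Ox].
  - by rewrite divg1 mulg1.
  - by rewrite invgK; have [] := Vg x Ox.
  - split; rewrite ?invgM mulgA.
      by have [+ _] := Vg x Ox => /Vh[].
    by have [_ +] := Vh x Ox => /Vg[].
exists V; split=> //; last first.
  by move=> g /(_ _ O1)[+ _]; rewrite mul1g => /OA.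
apply/(open_subgroupP sV).
have /compact_near_coveringP := cptO.
apply=> x Ox.
have c1 : continuous (fun p : G * G => p.1 * p.2) by exact: mulg_continuous.
have c2 : continuous (fun p : G * G => p.1 / p.2).
  apply: continuous_mulg; first by move=> ?; exact: cvg_fst.
  by apply: continuous_invg => ?; exact: cvg_snd.
have nO : nbhs x O by apply: open_nbhs_nbhs.
apply: filterI; [apply: (c1 (x, 1))|apply: (c2 (x, 1))] => /=.
  by rewrite mulg1.
by rewrite divg1.
Qed.

End Subgroups.

(** * Characteristic subgroups and normalizers *)

Section Automorphisms.
Variable G : topGroupType.
Implicit Types (H K S : set G) (f : G -> G).

Lemma topological_automorphismP f :
  topological_automorphism f <->
  [/\ {morph f : x y / x * y}, continuous f &
      exists g, [/\ cancel f g, cancel g f & continuous g]].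
Proof.
split=> [[fM [[_ _ fS] cf [g fK cg]]]|[fM cf [g [fK gK cg]]]].
  have fgK : cancel f g by move=> x; apply: fK; rewrite inE.
  split=> //; first exact/continuous_subspace_setT.
  exists g; split=> //; last exact/continuous_subspace_setT.
  by move=> y; have [x _ <-] := fS y I; rewrite fgK.
split=> //; split; last exists g.
- split=> // [x y _ _|y _]; first exact: (can_inj fK).
  by exists (g y).
- exact: continuous_subspaceT.
- by move=> x _; exact: fK.
- exact: continuous_subspaceT.
Qed.

Lemma topological_automorphism_inv f : topological_automorphism f ->
  exists g, [/\ topological_automorphism g, cancel f g & cancel g f].
Proof.
move=> /topological_automorphismP[fM cf [g [fK gK cg]]]; exists g; split=> //.
apply/topological_automorphismP; split=> //; last by exists f.
by move=> x y; apply: (can_inj fK); rewrite fM !gK.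
Qed.

Lemma topological_automorphism_conjg (g : G) :
  topological_automorphism (fun x => x ^ g).
Proof.
apply/topological_automorphismP; split.
- by move=> x y; exact: conjMg.
- exact: continuous_conjg.
- exists (fun x => x ^ g^-1); split; [exact: conjgK|exact: conjgKV|].
  exact: continuous_conjg.
Qed.

Lemma characteristicP S : characteristic S <->
  forall f, topological_automorphism f -> forall x, S x -> S (f x).
Proof.
split=> [cS f af x Sx|h f af]; first by rewrite -(cS f af); exists x.
apply/seteqP; split=> [_ [x Sx <-]|x Sx]; first exact: h.
have [g [ag fK gK]] := topological_automorphism_inv af.
by exists (g x); [exact: h | exact: gK].
Qed.

Lemma characteristic_conjg S (x g : G) : characteristic S -> S x -> S (x ^ g).
Proof.
by move=> /characteristicP/(_ _ (topological_automorphism_conjg g)); apply.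
Qed.

Lemma characteristic_closure S : characteristic S -> characteristic (closure S).
Proof.
move=> /characteristicP cS; apply/characteristicP => f af x clx A nA.
have /topological_automorphismP[_ cf _] := af.
have [y [Sy Ay]] := clx _ (cf x A nA).
by exists (f y); split=> //; exact: cS.
Qed.

Lemma normalizerP K (g : G) :
  normalizer K g <-> forall x, K (x ^ g) <-> K x.
Proof.
split=> [nK x|h].
  split=> [|Kx]; last by rewrite -nK; exists x.
  by rewrite -{1}nK => -[y Ky] /conjg_inj <-.
apply/seteqP; split=> [_ [x Kx <-]|x Kx]; first exact/h.
by exists (x ^ g^-1); [apply/h; rewrite conjgKV | exact: conjgKV].
Qed.

Lemma normalizer_subgroup K : subgroup (normalizer K).
Proof.
apply: subgroupP => [|g|g h].
- by apply/normalizerP => x; rewrite conjg1.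
- move=> /normalizerP h; apply/normalizerP => x.
  by rewrite -[K (x ^ _)]h conjgKV.
- move=> /normalizerP hg /normalizerP hh; apply/normalizerP => x.
  by rewrite conjgM hh hg.
Qed.

Lemma normalizer_characteristic S : characteristic S -> normalizer S = [set: G].
Proof.
move=> cS; apply/seteqP; split=> // g _.
exact: cS (topological_automorphism_conjg g).
Qed.

End Automorphisms.

(** * The quasi-centre, absolute and modulo a subgroup *)

Section QuasiCentre.
Variable G : topGroupType.
Implicit Types (H K S R : set G) (f : G -> G).

(** A centralizer is a subgroup, so it is relatively open as soon as it contains
    a relative neighbourhood of 1. *)
Lemma QZP H x : subgroup H ->
  QZ H x <-> H x /\ \forall u \near (1 : G), H u -> commute x u.
Proof.
move=> sH.
have sC : subgroup (centralizer1 H x).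
  apply: subgroupP => [|y [Hy xy]|y z [Hy xy] [Hz xz]].
  - by split; [exact: subgroup1|exact: commute1].
  - by split; [exact: subgroupV|exact: commuteV].
  - by split; [exact: subgroupM|exact: commuteM].
have CH : centralizer1 H x `<=` H by move=> y [].
split=> -[Hx].
  move=> /(open_in_subgroupP sH sC CH) nC; split=> //.
  by apply: filterS nC => u h /h[].
move=> nC; split=> //; apply/(open_in_subgroupP sH sC CH).
by apply: filterS nC => u h Hu; split=> //; exact: h.
Qed.

Lemma QZ_subgroup H : subgroup H -> subgroup (QZ H).
Proof.
move=> sH; apply: subgroupP => [|x /(QZP _ sH)[Hx nx]|x y].
- apply/(QZP _ sH); split; first exact: subgroup1.
  by apply: filterE => u _; exact/commute_sym/commute1.
- apply/(QZP _ sH); split; first exact: subgroupV.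
  by apply: filterS nx => u h Hu; exact/commute_sym/commuteV/commute_sym/h.
move=> /(QZP _ sH)[Hx nx] /(QZP _ sH)[Hy ny]; apply/(QZP _ sH).
split; first exact: subgroupM.
apply: filterS (filterI nx ny) => u [hx hy] Hu.
by apply/commute_sym/commuteM; apply/commute_sym; [exact: hx|exact: hy].
Qed.

Lemma QZ_sub H K : subgroup H -> subgroup K -> K `<=` H -> QZ H `&` K `<=` QZ K.
Proof.
move=> sH sK KH x [/(QZP _ sH)[_ nx] Kx]; apply/(QZP _ sK); split=> //.
by apply: filterS nx => u h /KH; exact: h.
Qed.

Lemma characteristic_QZ : characteristic (QZ [set: G]).
Proof.
apply/characteristicP => f af x /(QZP _ (subgroupT G))[_ nx].
apply/(QZP _ (subgroupT G)); split=> //.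
have [g [ag fK gK]] := topological_automorphism_inv af.
have /topological_automorphismP[gM cg _] := ag.
have /topological_automorphismP[fM _ _] := af.
have g1 : g 1 = 1 by apply: (@mulgI _ (g 1)); rewrite -gM !mulg1.
have ngx : nbhs (1 : G) (g @^-1` [set u | [set: G] u -> commute x u]).
  by apply: cg; rewrite g1.
apply: filterS ngx => u /= h _.
by rewrite -(gK u) /commute -!fM; congr (f _); exact: h.
Qed.

(** For a normal subgroup R this is the preimage in G of the quasi-centre of
    G / R. *)
Definition QZmod R : set G := [set g | \forall u \near (1 : G), R [~ g, u]].

Section Mod.
Variable R : set G.
Hypotheses (sR : subgroup R) (cR : characteristic R).

Lemma sub_QZmod : R `<=` QZmod R.
Proof.
move=> g Rg; apply: filterE => u; rewrite commgEl.
by apply: subgroupM; [|exact: subgroupV|exact: characteristic_conjg].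
Qed.

Lemma QZmod_subgroup : subgroup (QZmod R).
Proof.
apply: subgroupP => [|x nx|x y nx ny].
- exact: sub_QZmod (subgroup1 sR).
- apply: filterS nx => u Ru.
  have -> : [~ x^-1, u] = [~ x, u]^-1 ^ x^-1.
    by rewrite /commg /conjg !invgM !invgK !mulgA mulgK.
  by apply: characteristic_conjg => //; exact: subgroupV.
- apply: filterS (filterI nx ny) => u [Rx Ry].
  have -> : [~ x * y, u] = [~ x, u] ^ y * [~ y, u].
    by rewrite /commg /conjg !invgM !mulgA mulgK mulgK.
  by apply: subgroupM => //; exact: characteristic_conjg.
Qed.

Lemma characteristic_QZmod : characteristic (QZmod R).
Proof.
apply/characteristicP => f af x nx.
have [g [ag fK gK]] := topological_automorphism_inv af.
have /topological_automorphismP[gM cg _] := ag.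
have /topological_automorphismP[fM _ _] := af.
have g1 : g 1 = 1 by apply: (@mulgI _ (g 1)); rewrite -gM !mulg1.
have f1 : f 1 = 1 by rewrite -g1 gK.
have fV y : f y^-1 = (f y)^-1.
  by apply: (@mulgI _ (f y)); rewrite -fM !mulgV.
have ngx : nbhs (1 : G) (g @^-1` [set u | R [~ x, u]]).
  by apply: cg; rewrite g1.
apply: filterS ngx => u /= Rxu.
rewrite -{1}(gK u) /commg /conjg -!fV -!fM.
by move/characteristicP : cR => /(_ f af); apply.
Qed.

End Mod.
End QuasiCentre.

(** * Direct products, locally at the identity *)

Section Splits.
Variable G : topGroupType.
Implicit Types (L M U V T N : set G).

(** A form of [direct_product] that needs no homeomorphism: multiplication
    L x M -> U is a group morphism, so its inverse is continuous as soon as it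
    is continuous at 1, which is what the last clause says. *)
Definition splits U L M :=
  [/\ [/\ subgroup L, subgroup M, L `<=` U & M `<=` U],
      forall l m, L l -> M m -> commute l m,
      forall x, L x -> M x -> x = 1,
      forall u, U u -> exists l m, [/\ L l, M m & u = l * m] &
      forall N, nbhs (1 : G) N -> \forall u \near (1 : G), U u ->
        exists l m, [/\ L l, M m, N l, N m & u = l * m]].

Lemma splits_uniq U L M l m l' m' : splits U L M ->
  L l -> M m -> L l' -> M m' -> l * m = l' * m' -> l = l' /\ m = m'.
Proof.
move=> [[sL sM _ _] _ LM _ _] Ll Mm Ll' Mm' e.
have e' : l'^-1 * l = m' * m^-1.
  by rewrite -[l](mulgK m) e !mulgA mulVg mul1g.
have x1 : l'^-1 * l = 1.
  apply: LM; first by apply: subgroupM => //; exact: subgroupV.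
  by rewrite e'; apply: sM.2.
have ll : l = l' by rewrite -[l']mulg1 -x1 mulgA mulgV mul1g.
by split=> //; move: e; rewrite ll => /mulgI.
Qed.

(** The two projections of U are continuous, and each factor is the kernel of one
    of them; this is why the factors are closed. *)
Lemma splits_direct_product U L M :
  hausdorff_space G -> subgroup U -> splits U L M -> direct_product U L M.
Proof.
move=> hG sU spl; have [[sL sM LU MU] cLM LM dec ndec] := spl.
have [g gP] : {g : G -> G * G & forall u, U u ->
    [/\ L (g u).1, M (g u).2 & u = (g u).1 * (g u).2]}.
  apply: (@choice _ _ (fun u p => U u ->
    [/\ L p.1, M p.2 & u = p.1 * p.2])) => u.
  have [Uu|nUu] := pselect (U u); last by exists (1, 1).
  by have [l [m h]] := dec u Uu; exists (l, m).
have gE l m : L l -> M m -> g (l * m) = (l, m).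
  move=> Ll Mm; have Ulm : U (l * m) by apply: subgroupM; [|exact: LU|exact: MU].
  have [L1 M2 e] := gP _ Ulm.
  have [el em] := splits_uniq spl Ll Mm L1 M2 e.
  by rewrite [LHS]surjective_pairing -el -em.
have cg : {within U, continuous g}.
  apply/subspace_continuousP => u0 Uu0 A [[B C] /= [nB nC] BC].
  have [L1 M2 e] := gP _ Uu0.
  have nN : nbhs (1 : G) ([set x | B ((g u0).1 * x)] `&` [set x | C ((g u0).2 * x)]).
    by apply: filterI; apply: (nbhs_mulP _ _).1.
  rewrite /fmap /= /within /=; apply/nbhs_mulP.
  apply: filterS (ndec _ nN) => v h Uu0v.
  have [|l [m [Ll Mm [/= Bl _] [/= _ Cm] ev]]] := h.
    by rewrite -[v]mul1g -(mulVg u0) -mulgA; apply: subgroupM => //; exact: subgroupV.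
  apply: BC; rewrite ev.
  have -> : u0 * (l * m) = ((g u0).1 * l) * ((g u0).2 * m).
    by rewrite {1}e !mulgA -[in RHS](mulgA _ l) (cLM _ _ Ll M2) mulgA.
  by rewrite /from_subspace gE; [split|exact: subgroupM|exact: subgroupM].
have closed_proj (p : G * G -> G) : continuous p ->
    closed (U `&` [set u | p (g u) = 1] : set (subspace U)).
  move=> cp; apply: closedI; first exact: closed_subspaceT.
  have cpg : {within U, continuous (p \o g)}.
    by move=> x; apply: (@continuous_comp (subspace U) _ _ g p); [exact: cg|exact: cp].
  move/continuous_closedP : cpg => /(_ [set 1]); apply.
  exact: accessible_closed_set1 (hausdorff_accessible hG) _.
split=> //.
- split=> //; have -> : L = U `&` [set u | (g u).2 = 1].
    apply/seteqP; split=> [l Ll|u [/gP[Lu Mu e] /= gu2]].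
      by split; [exact: LU|rewrite /= -[l]mulg1 gE //; exact: subgroup1].
    by rewrite e gu2 mulg1.
  by apply: closed_proj => //; move=> ?; exact: cvg_snd.
- split=> //; have -> : M = U `&` [set u | (g u).1 = 1].
    apply/seteqP; split=> [m Mm|u [/gP[Lu Mu e] /= gu1]].
      by split; [exact: MU|rewrite /= -[m]mul1g gE //; exact: subgroup1].
    by rewrite e gu1 mul1g.
  by apply: closed_proj => //; move=> ?; exact: cvg_fst.
- split.
  + split=> [[l m] /= [Ll Mm]|[l m] [l' m']|u Uu].
    * by apply: subgroupM; [|exact: LU|exact: MU].
    * rewrite !inE => -[/= Ll Mm] [/= Ll' Mm'] e.
      by have [-> ->] := splits_uniq spl Ll Mm Ll' Mm' e.
    * by have [Lu Mu e] := gP u Uu; exists (g u).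
  + apply: continuous_subspaceT; exact: mulg_continuous.
  + by exists g => // -[l m]; rewrite inE => -[/= Ll Mm]; exact: gE.
Qed.

Lemma direct_product_splits U L M :
  subgroup U -> direct_product U L M -> splits U L M.
Proof.
move=> sU [[sL LU _] [sM MU _] cLM [[_ inj surj] _ [g gK cg]]].
have L1 := subgroup1 sL; have M1 := subgroup1 sM.
split=> // [x Lx Mx|u Uu|N nN].
- have [] : (x, 1 : G) = (1, x); last by [].
  by apply: inj; rewrite ?inE //= mulg1 mul1g.
- by have [[l m] /= [Ll Mm] <-] := surj u Uu; exists l, m.
have g1 : g 1 = (1, 1).
  by rewrite -[in LHS](mulg1 1); apply: (gK (1, 1)); rewrite inE.
have U1 := subgroup1 sU.
move/subspace_continuousP : cg => /(_ 1 U1 (N `*` N)); rewrite /from_subspace g1 => cg.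
have {cg}: \forall u \near (1 : G), U u -> (N `*` N) (g u).
  by apply: cg; exists (N, N).
apply: filterS => u h Uu; have := h Uu.
have [[l m] /= [Ll Mm] <-] := surj u Uu.
by rewrite (gK (l, m)) ?inE // => -[/= Nl Nm]; exists l, m.
Qed.

(** Dedekind's modular law, with its topology. *)
Lemma splits_dedekind U L M T : subgroup T -> L `<=` T ->
  splits U L M -> splits (U `&` T) L (M `&` T).
Proof.
move=> sT LT [[sL sM LU MU] cLM LM dec ndec].
split=> [|l m Ll [Mm _]|x Lx [Mx _]|u [Uu Tu]|N nN].
- split=> //; first exact: subgroupI.
    by move=> l Ll; split; [exact: LU|exact: LT].
  by move=> m [Mm Tm]; split=> //; exact: MU.
- exact: cLM.
- exact: LM.
- have [l [m [Ll Mm e]]] := dec u Uu.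
  exists l, m; split=> //; split=> //.
  by apply: (subgroup_cancell sT (LT _ Ll)); rewrite -e.
- apply: filterS (ndec N nN) => u h [/h[l [m [Ll Mm Nl Nm e]]] Tu].
  exists l, m; split=> //; split=> //.
  by apply: (subgroup_cancell sT (LT _ Ll)); rewrite -e.
Qed.

(** The subgroup W is the product of L and M `&` V; it is open because
    elements of U near 1 have their second component in V. *)
Lemma splits_shrink U L M V : subgroup U -> open U -> splits U L M ->
  subgroup V -> open V ->
  exists W, [/\ subgroup W, open W & splits W L (M `&` V)].
Proof.
move=> sU oU spl sV oV; have [[sL sM LU MU] cLM LM dec ndec] := spl.
have sMV := subgroupI sM sV.
have nU : nbhs (1 : G) U by exact/open_subgroupP.
have nV : nbhs (1 : G) V by exact/open_subgroupP.
pose W := [set u | exists l m, [/\ L l, (M `&` V) m & u = l * m]].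
have sW : subgroup W.
  apply: subgroupP => [|_ [l [m [Ll Mm ->]]]|].
  - by exists 1, 1; split; [exact: subgroup1|exact: subgroup1|rewrite mulg1].
  - exists l^-1, m^-1; split; [exact: subgroupV|exact: subgroupV|].
    by rewrite -invgM (cLM _ _ Ll Mm.1).
  - move=> _ _ [l [m [Ll Mm ->]]] [l' [m' [Ll' Mm' ->]]].
    exists (l * l'), (m * m'); split; [exact: subgroupM|exact: subgroupM|].
    by rewrite !mulgA -(mulgA l m) -(cLM _ _ Ll' Mm.1) mulgA.
have ndecW N : nbhs (1 : G) N -> \forall u \near (1 : G),
    exists l m, [/\ L l, (M `&` V) m, N l, N m & u = l * m].
  move=> nN; apply: filterS (filterI nU (ndec _ (filterI nN nV))) => u [Uu h].
  by have [l [m [Ll Mm [Nl _] [Nm Vm] e]]] := h Uu; exists l, m.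
exists W; split=> //.
  apply/(open_subgroupP sW); apply: filterS (ndecW _ nU) => u.
  by move=> [l [m [Ll Mm _ _ ->]]]; exists l, m.
split=> [|l m Ll [Mm _]|x Lx [Mx _]|//|N nN].
- split=> // [l Ll|m Mm].
    by exists l, 1; split=> //; [exact: subgroup1|rewrite mulg1].
  by exists 1, m; split=> //; [exact: subgroup1|rewrite mul1g].
- exact: cLM.
- exact: LM.
- by apply: filterS (ndecW N nN).
Qed.

End Splits.

(** * Local complements from property (LD) *)

(** Property (LD) splits off an open subgroup L of R from an open subgroup of G.
    The second factor meets R in a discrete subgroup; van Dantzig's theorem
    provides an open subgroup V with V `&` R inside L, and intersecting the
    second factor with V makes it meet R trivially. *)
Lemma LD_complement (G : topGroupType) (R : set G) :
  propertyLD G -> subgroup R -> closed R -> open (normalizer R) ->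
  exists U L M : set G,
    [/\ subgroup U, open U, splits U L M & closed M] /\
    [/\ L `<=` R & forall x, M x -> R x -> x = 1].
Proof.
move=> [tG ldG] sR cR /(ldG _ sR cR) [L [U [[sL LR oL] sU oU [M0 dp]]]].
have spl := direct_product_splits sU dp.
have cM0 : closed M0.
  have [_ [_ M0U /closed_subspaceP[C cC CM0]] _ _] := dp.
  have -> : M0 = C `&` U by rewrite CM0; exact/esym/setIidPl.
  by apply: closedI => //; exact: open_subgroup_closed.
have nL := (open_in_subgroupP sR sL LR).1 oL.
have [V [sV oV VL]] := van_dantzig tG nL.
have [W [sW oW splW]] := splits_shrink sU oU spl sV oV.
exists W, L, (M0 `&` V); split; first split=> //.
  by apply: closedI => //; exact: open_subgroup_closed.
split=> // x [Mx Vx] Rx; have [_ _ LM _ _] := spl.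
by apply: LM => //; exact: VL.
Qed.

(** * Images under open morphisms *)

Section OpenMorphism.
Variables (G H : topGroupType) (f : G -> H).
Hypotheses (fM : {morph f : x y / x * y}) (cf : continuous f).
Hypotheses (fS : forall z, exists x, f x = z).
Hypothesis (fO : forall A, open A -> open (f @` A)).

Lemma morph_1 : f 1 = 1.
Proof. by apply: (@mulgI _ (f 1)); rewrite -fM !mulg1. Qed.

Lemma morph_V x : f x^-1 = (f x)^-1.
Proof. by apply: (@mulgI _ (f x)); rewrite -fM !mulgV morph_1. Qed.

Lemma morph_J x y : f (x ^ y) = f x ^ f y.
Proof. by rewrite /conjg !fM morph_V. Qed.

Lemma morph_R x y : f [~ x, y] = [~ f x, f y].
Proof. by rewrite /commg fM morph_J morph_V. Qed.

Lemma image_subgroup (S : set G) : subgroup S -> subgroup (f @` S).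
Proof.
move=> sS; split; first by exists 1; [exact: subgroup1|exact: morph_1].
move=> _ _ [x Sx <-] [y Sy <-]; exists (x / y); first exact: sS.2.
by rewrite fM morph_V.
Qed.

Lemma preimage_subgroup (S : set H) : subgroup S -> subgroup (f @^-1` S).
Proof.
move=> sS; split; first by rewrite /= morph_1; exact: subgroup1.
by move=> x y Sx Sy; rewrite /= fM morph_V; exact: sS.2.
Qed.

Lemma image_nbhs x A : nbhs x A -> nbhs (f x) (f @` A).
Proof.
rewrite !nbhsE => -[O [oO Ox] OA].
by exists (f @` O); [split; [exact: fO|exists x]|exact: image_subset].
Qed.

Lemma preimage_nbhs1 A : nbhs (1 : H) A -> nbhs (1 : G) (f @^-1` A).
Proof. by move=> nA; apply: cf; rewrite morph_1. Qed.

(** Total disconnectedness alone can be lost under open morphisms of topological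
    groups; local compactness of G provides small open subgroups, and their
    images are small open subgroups of H. *)
Lemma image_tdlc : tdlc G -> closed [set x | f x = 1] -> tdlc H.
Proof.
move=> tG cK; have [hG lG _] := tG.
have c1 : closed [set (1 : H)].
  rewrite -openC; have -> : ~` [set (1 : H)] = f @` (~` [set x | f x = 1]).
    apply/seteqP; split=> [z nz|_ [x nx <-]]; last exact: nx.
    by have [x fx] := fS z; exists x => //= fx1; apply: nz; rewrite -fx.
  by apply: fO; exact: closed_openC.
have hH := closed1_hausdorff c1; split=> //.
- move=> z _; have [x <-] := fS z.
  have [K + [cptK clK]] := lG x I; rewrite !withinET => nK.
  have cptfK : compact (f @` K).
    by apply: continuous_compact => //; exact: continuous_subspaceT.
  exists (f @` K); last by split=> //; exact: compact_closed.
  by exact: image_nbhs.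
- apply: open_subgroup_totally_disconnected => z nz.
  have nN : nbhs (1 : H) (~` [set z]).
    apply: open_nbhs_nbhs; split; last by move=> /= /esym.
    apply: closed_openC; exact: accessible_closed_set1 (hausdorff_accessible hH) _.
  have [V [sV oV VN]] := van_dantzig tG (preimage_nbhs1 nN).
  exists (f @` V); split; [exact: image_subgroup|exact: fO|].
  by move=> [x /VN/=].
Qed.

Section Complement.
Variables (U L M : set G).
Hypotheses (sU : subgroup U) (oU : open U) (spl : splits U L M).
Hypotheses (Lker : forall l, L l -> f l = 1).
Hypothesis (Mker : forall m, M m -> f m = 1 -> m = 1).

Let sM : subgroup M. Proof. by case: spl => -[]. Qed.

Lemma complement_inj x y : M x -> M y -> f x = f y -> x = y.
Proof.
move=> Mx My e; apply: divg1_eq; apply: Mker; first exact: sM.2.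
by rewrite fM morph_V e mulgV.
Qed.

Lemma complement_near N : nbhs (1 : G) N ->
  \forall u \near (1 : G), exists l m, [/\ L l, M m, N l, N m & u = l * m].
Proof.
move=> nN; have [_ _ _ _ ndec] := spl.
have nU : nbhs (1 : G) U by exact/open_subgroupP.
by apply: filterS (filterI nU (ndec N nN)) => u [Uu]; apply.
Qed.

(** The factor L dies in H, so M alone covers a neighbourhood of 1: with
    injectivity on M, this makes f a local isomorphism from M to H. *)
Lemma complement_image_nbhs N : nbhs (1 : G) N -> nbhs (1 : H) (f @` (M `&` N)).
Proof.
move=> /complement_near/image_nbhs; rewrite morph_1; apply: filterS.
move=> _ [_ [l [m [Ll Mm _ Nm ->]]] <-]; exists m; first by split.
by rewrite fM (Lker Ll) mul1g.
Qed.

Lemma image_splits (W A B : set G) : W `<=` M -> splits W A B ->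
  splits (f @` W) (f @` A) (f @` B).
Proof.
move=> WM [[sA sB AW BW] cAB AB dec ndec].
split=> [|_ _ [a Aa <-] [b Bb <-]|_ [a Aa <-] [b Bb e]|_ [w Ww <-]|N nN].
- split; [exact: image_subgroup|exact: image_subgroup|exact: image_subset|].
  exact: image_subset.
- by rewrite /commute -!fM (cAB a b).
- have ab : a = b by apply: complement_inj => //; [exact/WM/AW|exact/WM/BW].
  by rewrite (AB a) ?morph_1 // ab.
- have [a [b [Aa Bb ->]]] := dec w Ww.
  by exists (f a), (f b); split; [exists a|exists b|exact: fM].
have := complement_image_nbhs (ndec _ (preimage_nbhs1 nN)).
apply: filterS => _ [m [Mm h] <-] [w Ww e].
have mw : m = w by apply: complement_inj => //; exact: WM.
have [a [b [Aa Bb Na Nb em]]] : exists a b, [/\ A a, B b, N (f a), N (f b) & m = a * b].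
  by apply: h; rewrite mw.
exists (f a), (f b); split=> //; by rewrite em fM.
Qed.

(** A closed subgroup K of H with open normalizer is pulled back to P inside M.
    Elements near 1 in G are products l * m, where l centralizes M and f m
    normalizes K, so P has open normalizer and (LD) in G applies to it.  Taking
    P inside M, rather than the full preimage of K, ensures that the factor A is
    contained in M and that Dedekind's law applies. *)
Lemma image_propertyLD : closed M -> propertyLD G -> tdlc H -> propertyLD H.
Proof.
move=> cM [tG ldG] tH; split=> // K sK cK oNK.
have [hH _ _] := tH.
have [_ cLM _ _ _] := spl.
pose P := M `&` f @^-1` K.
have sP : subgroup P by apply: subgroupI => //; exact: preimage_subgroup.
have cP : closed P.
  by apply: closedI => //; move: K cK {sK oNK P sP}; exact/continuous_closedP.
have nNK : nbhs (1 : H) (normalizer K).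
  exact/(open_subgroupP (normalizer_subgroup K)).
have oNP : open (normalizer P).
  apply/(open_subgroupP (normalizer_subgroup P)).
  apply: filterS (complement_near (preimage_nbhs1 nNK)).
  move=> _ [l [m [Ll Mm _ /normalizerP Nm ->]]].
  have cP' x : P x -> x ^ l = x.
    move=> [Mx _]; apply/conjg_fixP/commgP; apply: commute_sym.
    exact: cLM.
  apply: subgroupM; first exact: normalizer_subgroup.
    apply/normalizerP => x; split=> [Pxl|Px]; last by rewrite cP'.
    by have /conjg_inj <- := cP' _ Pxl.
  apply/normalizerP => x; split=> -[Mx Kx]; split.
  - rewrite -(conjgK m x) conjgE; apply: subgroupM => //.
      by apply: subgroupV => //; apply: subgroupV.
    by apply: subgroupM => //; exact: subgroupV.
  - by move: Kx; rewrite /= morph_J => /Nm.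
  - by apply: subgroupM; [|exact: subgroupV|exact: subgroupM].
  - by rewrite /= morph_J; exact/Nm.
have [A [V [[sA AP oA] sV oV [B dp]]]] := ldG P sP cP oNP.
have AM : A `<=` M by move=> x /AP[].
have splA := splits_dedekind sM AM (direct_product_splits sV dp).
have nA := (open_in_subgroupP sP sA AP).1 oA.
have nV : nbhs (1 : G) V by exact/open_subgroupP.
have sfVM : subgroup (f @` (V `&` M)) by apply: image_subgroup; exact: subgroupI.
have AK : f @` A `<=` K by move=> _ [a /AP[_ Ka] <-].
exists (f @` A), (f @` (V `&` M)); split=> //.
- split=> //; first exact: image_subgroup.
  apply/(open_in_subgroupP sK (image_subgroup sA) AK).
  apply: filterS (complement_image_nbhs nA) => _ [m [Mm Am] <-] Km.
  by exists m => //; exact: Am.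
- by apply/(open_subgroupP sfVM); rewrite setIC; exact: complement_image_nbhs.
- exists (f @` (B `&` M)); apply: splits_direct_product => //.
  by apply: image_splits => // x [].
Qed.

End Complement.
End OpenMorphism.

(** * The subgroup Q and the quotient by it *)

Section QuotientMap.
Variables (G : topGroupType) (Q : normal_subgroup G).
Local Open Scope quotient_scope.

Definition quotient_map : G -> quotient_group Q := \pi_(quotient_group Q).

Lemma quotient_mapM : {morph quotient_map : x y / x * y}.
Proof. by move=> x y; rewrite -[LHS]quotient_pi_mul. Qed.

Lemma quotient_map_surj z : exists x, quotient_map x = z.
Proof. by exists (repr z); exact: reprK. Qed.

Lemma quotient_map1 x : quotient_map x = 1 <-> normal_set Q x.
Proof.
rewrite -(morph_1 quotient_mapM); split.
  move=> /esym/quotient_piP; by rewrite invg1 mul1g.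
by move=> Qx; apply/esym/quotient_piP; rewrite invg1 mul1g.
Qed.

End QuotientMap.

Section LocalStructure.
Variable G : topGroupType.
Hypothesis ldG : propertyLD G.

Let R := closure (QZ [set: G]).
Let Q := QZmod R.

Lemma closure_QZ_subgroup : subgroup R.
Proof. exact/closure_subgroup/QZ_subgroup/subgroupT. Qed.

Lemma characteristic_closure_QZ : characteristic R.
Proof. exact/characteristic_closure/characteristic_QZ. Qed.

Let sR := closure_QZ_subgroup.
Let cR := characteristic_closure_QZ.
Let sQ : subgroup Q := QZmod_subgroup sR cR.
Let RQ : R `<=` Q := sub_QZmod sR cR.

(** The complement M to R meets QZmod R trivially too: commutators of x in
    M `&` QZmod R with elements of M near 1 lie in M `&` R, so x
    commutes with M near 1 and with L, hence x is in QZ(G). *)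
Lemma QZmod_complement : exists U L M : set G,
    [/\ subgroup U, open U, splits U L M & closed M] /\
    [/\ L `<=` R & forall x, M x -> Q x -> x = 1].
Proof.
have [||U [L [M [[sU oU spl cM] [LR MR]]]]] := LD_complement ldG sR.
- exact: closed_closure.
- by rewrite normalizer_characteristic //; exact: openT.
exists U, L, M; split=> //; split=> // x Mx Qx.
apply: (MR _ Mx); apply: subset_closure; apply/(QZP _ (subgroupT G)).
split=> //; have [[_ sM _ _] cLM _ _ _] := spl.
apply: filterS (complement_near sU oU spl Qx) => _ [l [m [Ll Mm _ Rxm ->]]] _.
apply: commuteM; first by apply: commute_sym; exact: cLM.
apply/commgP/eqP; apply: MR => //.
do 2![apply: subgroupM => //; first exact: subgroupV].
exact: subgroupM.
Qed.

(** An element of Q near 1 is l * m with l in R; then m is in M `&` Q, so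
    m = 1. *)
Lemma QZmod_near : \forall u \near (1 : G), Q u -> R u.
Proof.
have [U [L [M [[sU oU spl cM] [LR MQ]]]]] := QZmod_complement.
apply: filterS (complement_near sU oU spl filterT) => _ [l [m [Ll Mm _ _ ->]]] Qlm.
have -> : m = 1.
  by apply: MQ => //; apply: (subgroup_cancell sQ _ Qlm); exact/RQ/LR.
by rewrite mulg1; exact: LR.
Qed.

End LocalStructure.

Theorem lemma1p10 (G : topGroupType) (tdlcG : tdlc G) (ldG : propertyLD G) :
  exists Q : normal_subgroup G,
    [/\ characteristic Q,
        closed (Q : set G),
        propertyLD (quotient_group Q),
        QZ [set: quotient_group Q] = [set 1%g] &
        open (closure (QZ Q : set (subspace Q)) : set (subspace Q))].
Proof.
pose R := closure (QZ [set: G]); pose Q := QZmod R.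
have sR : subgroup R := closure_QZ_subgroup G.
have cR : characteristic R := characteristic_closure_QZ (G := G).
have sQ : subgroup Q := QZmod_subgroup sR cR.
have cQ : characteristic Q := characteristic_QZmod cR.
have RQ : R `<=` Q := sub_QZmod sR cR.
have nQR : \forall u \near (1 : G), Q u -> R u := QZmod_near ldG.
have clQ : closed Q.
  exact: (closed_of_locally_closed sQ sR (@closed_closure _ _) RQ nQR).
pose Qn := NormalSubgroup sQ (fun x g => @characteristic_conjg G Q x g cQ).
have pM := @quotient_mapM G Qn.
have pC : continuous (@quotient_map G Qn) by exact: quotient_pi_continuous.
have pO A : open A -> open (@quotient_map G Qn @` A) by exact: quotient_pi_open.
have pS := @quotient_map_surj G Qn.
have p1 := @quotient_map1 G Qn.
have tH : tdlc (quotient_group Qn).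
  apply: (image_tdlc pM pC pS pO) => //.
  by rewrite (_ : [set x | _] = Q) //; apply/seteqP; split=> x /p1.
have [U [L [M [[sU oU spl cM] [LR MQ]]]]] := QZmod_complement ldG.
exists Qn; split=> //.
- apply: (image_propertyLD pM pC pO sU oU spl) => //.
    by move=> l /LR/RQ/p1.
  by move=> m Mm /p1; exact: MQ.
- apply/seteqP; split=> [z /(QZP _ (subgroupT _))[_ nz]|_ ->]; last first.
    exact: subgroup1 (QZ_subgroup (subgroupT _)).
  have [g gz] := pS z; rewrite -gz in nz *; apply/p1.
  have nQ : \forall u \near (1 : G), Q [~ g, u].
    apply: filterS (preimage_nbhs1 pM pC nz) => u /= h.
    by apply/p1; rewrite (morph_R pM); apply/eqP/commgP; exact: h.
  (* [~ g, u] tends to 1 with u, and near 1 membership in Q is membership in R. *)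
  have nQR' : \forall u \near (1 : G), Q [~ g, u] -> R [~ g, u].
    by have := @continuous_commg G g 1 [set v | Q v -> R v]; rewrite commg1; exact.
  by apply: filterS (filterI nQ nQR') => u [Qu]; exact.
- have QZQ : QZ Q `<=` Q by move=> x [].
  change (open (closure (QZ Q : set (subspace Q)) : set (subspace Q))).
  rewrite closure_subspaceW //.
  have sC : subgroup (closure (QZ Q) `&` Q).
    by apply: subgroupI => //; exact/closure_subgroup/QZ_subgroup.
  apply/(open_in_subgroupP sQ sC); first by move=> x [].
  apply: filterS nQR => u h Qu; split=> //.
  apply: closureS (h Qu) => x QZx.
  apply: (QZ_sub (subgroupT _) sQ) => //; split=> //.
  exact/RQ/subset_closure.
Qed.
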